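(* Let $n\ge1$, let $\Omega\subset\mathbb{R}^n$ be a smooth bounded domain, let $\gamma\in C^3([0,\infty))$ satisfy $\gamma>0$ and $\gamma'\le0$ on $(0,\infty)$, and let $u_0\in C^0(\overline\Omega)$, $u_0\ge0$, $u_0\not\equiv0$. Let $v_*=0$ and suppose $\mu>\gamma(v_* )$. Let $(u,v)$ be the classical solution, on its maximal existence interval $[0,T_{\max})$, of $$\begin{cases} u_t=\Delta(\gamma(v)u)+\mu u(1-u), & x\in\Omega,\ t>0,\\ -\Delta v+v=u, & x\in\Omega,\ t>0,\\ \partial_\nu u=\partial_\nu v=0, & x\in\partial\Omega,\ t>0,\\ u(x,0)=u_0(x), & x\in\Omega.\end{cases}$$ Then for any $(x,t)\in\Omega\times[0,T_{\max})$, $$v(x,t)\le v_0(x)+\frac{\mu}{\mu-\gamma(v_* )},$$ where $v_0:=(I-\Delta)^{-1}u_0$.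
   Context: $(I-\Delta)^{-1}$ is the inverse of $I-\Delta$ with homogeneous Neumann boundary condition on $\Omega$. The problem has a unique classical solution $(u,v)\in\big(C^0(\overline\Omega\times[0,T_{\max}))\cap C^{2,1}(\overline\Omega\times(0,T_{\max}))\big)^2$ with maximal existence time $T_{\max}\in(0,\infty]$. *)

(* Defs.v *)
From HB Require Import structures.
From mathcomp Require Import all_boot all_order all_algebra.
From mathcomp Require Import all_classical all_reals all_analysis.

Set Implicit Arguments.
Unset Strict Implicit.
Unset Printing Implicit Defensive.

Import Order.TTheory GRing.Theory Num.Theory.
Import numFieldNormedType.Exports.

Local Open Scope classical_set_scope.
Local Open Scope ring_scope.

Section Regularity.
Context {R : realType}.

(* [f], considered on [A] only, has a continuous extension to [B]. *)
Definition continuous_up_to (T U : topologicalType) (A B : set T) (f : T -> U) :=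
  exists g : T -> U,
    {within B, continuous g} /\ (forall x, A x -> f x = g x).

Context {n : nat}.
Implicit Types (f w : 'rV[R]_n -> R) (A B U Omega : set 'rV[R]_n).

Definition partial (i : 'I_n) f : 'rV[R]_n -> R :=
  fun x => 'D_(delta_mx 0 i) f x.

Definition grad f (x : 'rV[R]_n) : 'rV[R]_n := \row_i partial i f x.

Definition laplacian f (x : 'rV[R]_n) : R :=
  \sum_(i < n) partial i (partial i f) x.

(* The norm of the library on ['rV[R]_n] is the sup norm. *)
Definition norm2 (x : 'rV[R]_n) : R := Num.sqrt (\sum_(i < n) x 0 i ^+ 2).

(* For [A] open: the partial derivatives of order at most [k] exist in [A] and
   extend continuously to [B]; [Ck_up_to k U U] is C^k on the open set [U]. *)
Fixpoint Ck_up_to (k : nat) A B f : Prop :=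
  continuous_up_to A B f /\
  match k with
  | 0%N => True
  | k'.+1 => forall i : 'I_n,
      (forall x, A x -> derivable f x (delta_mx 0 i)) /\
      Ck_up_to k' A B (partial i f)
  end.

Definition smooth_on U f := forall k, Ck_up_to k U U f.

(* [Ck_up_to] says nothing of the values of [f] outside of [Omega], whence the
   additional requirement on the boundary values of [f]. *)
Definition C2_closure Omega f :=
  {within closure Omega, continuous f} /\ Ck_up_to 2 Omega (closure Omega) f.

Definition bdry Omega : set 'rV[R]_n := closure Omega `\` Omega.

Definition local_defining_function Omega (x : 'rV[R]_n) U (rho : 'rV[R]_n -> R) :=
  [/\ open U, U x, smooth_on U rho, grad rho x != 0 &
      Omega `&` U = [set y | rho y < 0] `&` U].

Definition smooth_bounded_domain Omega :=
  [/\ Omega !=set0, open Omega, connected Omega, bounded_set Omega &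
      forall x, bdry Omega x ->
        exists U rho, local_defining_function Omega x U rho].

Definition outward_normal Omega (x nu : 'rV[R]_n) :=
  exists U rho, local_defining_function Omega x U rho /\
                nu = (norm2 (grad rho x))^-1 *: grad rho x.

(* The normal derivative on the boundary is the one-sided derivative taken from
   inside of the domain, as the values of [f] outside of the closure of [Omega]
   are irrelevant. *)
Definition neumann Omega f :=
  forall x nu, bdry Omega x -> outward_normal Omega x nu ->
    (fun h : R => h^-1 * (f x - f (x - h *: nu))) @ 0^'+ --> (0 : R).

(* [w = (I - Delta)^-1 f] for [f] continuous on the closure of [Omega].  For
   such [f] the solution [w] need not be C^2, so the inverse is that of the
   Neumann Laplacian in the space of continuous functions on the closure, i.e.
   of the closure (in the sup norm) of the operator acting on C^2 functions
   with vanishing normal derivative. *)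
Definition neumann_resolvent Omega f w :=
  forall e : R, 0 < e -> exists z : 'rV[R]_n -> R,
    [/\ C2_closure Omega z, neumann Omega z,
        forall x, closure Omega x -> `|z x - w x| <= e &
        forall x, Omega x -> `|z x - laplacian z x - f x| <= e].

Lemma neumann_resolvent_classical Omega f w :
  C2_closure Omega w -> neumann Omega w ->
  (forall x, Omega x -> w x - laplacian w x = f x) ->
  neumann_resolvent Omega f w.
Proof.
move=> w2 wN eqw e e0; exists w; split=> // x Ox.
  by rewrite subrr normr0 ltW.
by rewrite eqw// subrr normr0 ltW.
Qed.

(* C^3([0, oo[) : the values of [gamma] on negative reals are irrelevant. *)
Definition C3_halfline (gamma : R -> R) :=
  {within [set s : R | 0 <= s], continuous gamma} /\
  forall k, (k < 3)%N ->
    (forall s : R, 0 < s -> derivable (derive1n k gamma) s 1) /\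
    continuous_up_to [set s : R | 0 < s] [set s : R | 0 <= s] (derive1n k.+1 gamma).

End Regularity.

Section Problem.
Context {R : realType} {n : nat}.
Implicit Types (Omega : set 'rV[R]_n) (T : \bar R) (u v : 'rV[R]_n -> R -> R).

Definition time_co T : set R := [set t | 0 <= t /\ (t%:E < T)%E].
Definition time_oo T : set R := [set t | 0 < t /\ (t%:E < T)%E].

Definition C0_cylinder Omega T u :=
  {within closure Omega `*` time_co T, continuous (fun p => u p.1 p.2)}.

Definition C21_cylinder Omega T u :=
  let Q := Omega `*` time_oo T in
  let Qbar := closure Omega `*` time_oo T in
  [/\ {within Qbar, continuous (fun p => u p.1 p.2)},
      (forall p, Q p -> derivable (u p.1) p.2 1) /\
      continuous_up_to Q Qbar (fun p => derive1 (u p.1) p.2),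
      forall i : 'I_n,
        (forall p, Q p -> derivable (u ^~ p.2) p.1 (delta_mx 0 i)) /\
        continuous_up_to Q Qbar (fun p => partial i (u ^~ p.2) p.1) &
      forall i j : 'I_n,
        (forall p, Q p ->
          derivable (partial i (u ^~ p.2)) p.1 (delta_mx 0 j)) /\
        continuous_up_to Q Qbar
          (fun p => partial j (partial i (u ^~ p.2)) p.1)].

(* The requirement [0 <= v] is what makes [gamma (v x t)] meaningful, [gamma]
   being given on [0, oo[ only. *)
Definition classical_solution Omega (gamma : R -> R) (mu : R)
    (u0 : 'rV[R]_n -> R) T u v :=
  [/\ C0_cylinder Omega T u /\ C21_cylinder Omega T u,
      C0_cylinder Omega T v /\ C21_cylinder Omega T v,
      forall x t, closure Omega x -> time_co T t -> 0 <= v x t,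
      (forall x t, Omega x -> time_oo T t ->
        derive1 (u x) t = laplacian (fun y => gamma (v y t) * u y t) x
                      + mu * u x t * (1 - u x t) /\
        - laplacian (v ^~ t) x + v x t = u x t) /\
      (forall t, time_oo T t ->
        neumann Omega (u ^~ t) /\ neumann Omega (v ^~ t)) &
      forall x, Omega x -> u x 0 = u0 x].

Definition maximal_classical_solution Omega (gamma : R -> R) (mu : R)
    (u0 : 'rV[R]_n -> R) T u v :=
  [/\ (0%:E < T)%E, classical_solution Omega gamma mu u0 T u v &
      forall T' u' v', (T < T')%E ->
        classical_solution Omega gamma mu u0 T' u' v' ->
        ~ (forall x t, closure Omega x -> time_co T t ->
             u' x t = u x t /\ v' x t = v x t)].

End Problem.

(* Main.v *)
Require Import Defs.
From HB Require Import structures.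
From mathcomp Require Import all_boot all_order all_algebra.
From mathcomp Require Import all_classical all_reals all_analysis.
From mathcomp Require Import ring lra.

Set Implicit Arguments.
Unset Strict Implicit.
Unset Printing Implicit Defensive.

Import Order.TTheory GRing.Theory Num.Theory.
Import numFieldNormedType.Exports.

Local Open Scope classical_set_scope.
Local Open Scope ring_scope.

(* With c = gamma(0) + mu, the equations give formally
     v_t + gamma(v) u + c v = (I - Delta)^-1 [(gamma(v) + mu + c) u - mu u^2],
   and the bracket is at most c^2 / mu since 0 <= gamma(v) <= gamma(0).  As v_t
   need not have two space derivatives, v_t is replaced by the backward
   difference quotient of v, for which the comparison principle for I - Delta
   with Neumann conditions holds up to a small error.

   Let z be a regular approximation of v_0.  At a positive-time maximum point of
   v - z over the closed cylinder the difference quotient is nonnegative, and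
   u = v - Delta v >= v - Delta z, which is about v - z + u_0, so that u >= 0
   there as soon as v - z is not small; hence c v <= c^2 / mu.  This gives
   v - z <= c / mu up to small terms, and
   c / mu = 1 + gamma(0) / mu <= mu / (mu - gamma(0)). *)

(** * Continuity relative to a subset *)

Section WithinContinuity.
Context {R : realType}.

Lemma within_continuousP (T : topologicalType) (A : set T) (f : T -> R) :
  {within A, continuous f} <->
  forall x, A x -> forall e : R, 0 < e -> \forall y \near x, A y ->
    `|f x - f y| < e.
Proof.
split=> [/subspace_continuousP cf x Ax e e0|cf].
  have /cvgrPdist_lt /(_ e e0) := cf x Ax.
  by rewrite near_withinE.
apply/subspace_continuousP => x Ax; apply/cvgrPdist_lt => e e0.
by rewrite near_withinE; exact: cf.
Qed.

(** This carries relations available only inside the domain to its boundary. *)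
Lemma within_closure_le (T : topologicalType) (A : set T) (f : T -> R) M :
  {within closure A, continuous f} -> (forall x, A x -> f x <= M) ->
  forall x, closure A x -> f x <= M.
Proof.
move=> /within_continuousP cf fM x clx; rewrite leNgt; apply/negP => Mf.
have [|y [Ay]] := clx _ (cf x clx (f x - M) _); first by rewrite subr_gt0.
move=> /(_ (subset_closure Ay)); have := fM _ Ay.
by rewrite ltr_norml; lra.
Qed.

Lemma within_continuous_compose (T U : topologicalType) (A : set T) (B : set U)
    (f : T -> U) (g : U -> R) :
  {within A, continuous f} -> (forall x, A x -> B (f x)) ->
  {within B, continuous g} -> {within A, continuous (g \o f)}.
Proof.
move=> /subspace_continuousP cf AB /within_continuousP cg.
apply/within_continuousP => x Ax e e0.
have /(cf x Ax) := cg _ (AB _ Ax) _ e0; rewrite /within /=.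
move=> h; have {}h : \forall y \near x, A y -> B (f y) ->
  `|g (f x) - g (f y)| < e := h.
by apply: filterS h => y h Ay; exact/h/AB.
Qed.

Lemma within_continuousM (T : topologicalType) (A : set T) (f g : T -> R) :
  {within A, continuous f} -> {within A, continuous g} ->
  {within A, continuous (fun x => f x * g x)}.
Proof. by move=> cf cg x; apply: cvgM; [exact: cf|exact: cg]. Qed.

Lemma within_continuous_cst (T : topologicalType) (A : set T) (k : R) :
  {within A, continuous (fun=> k)}.
Proof. by move=> x; exact: cvg_cst. Qed.

Lemma within_continuous_sum (T : topologicalType) (A : set T) n
    (f : 'I_n -> T -> R) :
  (forall i, {within A, continuous (f i)}) ->
  {within A, continuous (fun x => \sum_i f i x)}.
Proof.
move=> cf; rewrite (_ : (fun x => _) = \sum_i f i); last first.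
  by apply/funext => x; rewrite fct_sumE.
elim/big_ind : _ => [|g h cg ch|i _]; last exact: cf.
  exact: within_continuous_cst.
exact: within_continuousD.
Qed.

(** Tube-lemma argument: continuity at [(x, s)] gives a product neighbourhood, and compactness of
    [K] makes its time factor uniform in [x]. *)
Lemma compact_slices_equicontinuous (T : topologicalType) (K : set T)
    (I : set R) (f : T * R -> R) (s : R) :
  compact K -> {within K `*` I, continuous f} -> I s ->
  forall e : R, 0 < e -> \forall t \near s, I t -> forall x, K x ->
    `|f (x, s) - f (x, t)| < e.
Proof.
move=> /compact_near_coveringP/near_covering_withinP cK /within_continuousP cf
  Is e e0.
have := cK R (within I (nbhs s)) (fun t x => `|f (x, s) - f (x, t)| < e) _.
have h : forall x, K x -> \forall x' \near x & t \near within I (nbhs s),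
  K x' -> `|f (x', s) - f (x', t)| < e.
  move=> x Kx; have e20 : 0 < e / 2 by rewrite divr_gt0.
  have [[U V] /= [nU nV] UV] := cf (x, s) (conj Kx Is) _ e20.
  exists (U, I `&` V) => /=.
    by split => //; apply: filterS nV => t Vt It; split.
  move=> [y t] [/= Uy [It Vt] Ky].
  (* Both [(y, t)] and [(y, s)] are compared with [(x, s)], whence [e / 2]. *)
  have h1 := UV (y, t) (conj Uy Vt) (conj Ky It).
  have h2 := UV (y, s) (conj Uy (nbhs_singleton nV)) (conj Ky Is).
  move: h1 h2; rewrite !ltr_norml; lra.
move=> /(_ ltac:(typeclasses eauto) h); rewrite near_withinE;
  apply: filterS => t Ht It x Kx; exact: Ht.
Qed.

End WithinContinuity.

(** * Directional derivatives and the mean value theorem *)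

Section Derivatives.
Context {R : realType}.

Lemma is_deriveP (V : normedModType R) (f : V -> R) (x v : V) (l : R) :
  is_derive x v f l <->
  forall e : R, 0 < e -> \forall h \near (0 : R), h != 0 ->
    `|l - h^-1 * (f (x + h *: v) - f x)| < e.
Proof.
split=> [[df dl] e e0|H].
  move: df => /cvg_ex[m fm].
  have ml : m = l by rewrite -dl; exact/esym/cvg_lim.
  move: fm; rewrite ml => /cvgrPdist_lt /(_ e e0); rewrite near_withinE.
  by apply: filterS => h /= + h0 => /(_ h0); rewrite [h *: v + x]addrC.
have : (fun h => h^-1 *: ((f \o shift x) (h *: v) - f x)) @ 0^' --> l.
  apply/cvgrPdist_lt => e e0; rewrite near_withinE.
  apply: filterS (H e e0) => h /= + h0 => /(_ h0).
  by rewrite [h *: v + x]addrC.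
move=> H1; split; first by apply/cvg_ex; exists l.
exact: cvg_lim.
Qed.

Lemma is_derive_lineP (V : normedModType R) (f : V -> R) (x v : V) (t l : R) :
  is_derive (x + t *: v) v f l <-> is_derive t 1 (fun h => f (x + h *: v)) l.
Proof.
have E h : f (x + (t + h *: 1) *: v) = f (x + t *: v + h *: v).
  by rewrite scalerDl addrA [h *: 1]mulr1.
by split=> /is_deriveP H; apply/is_deriveP => e /H;
  apply: filterS => h H1 /H1; rewrite E.
Qed.

Lemma is_derive_comp_real (V : normedModType R) (f : V -> R) (g : R -> R)
    (x v : V) (l m : R) :
  is_derive x v f l -> is_derive (f x) 1 g m ->
    is_derive x v (fun y => g (f y)) (m * l).
Proof.
move=> df dg.
have df0 : is_derive (0 : R) 1 (fun h : R => f (x + h *: v)) l.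
  by apply: (is_derive_lineP f x v 0 l).1; rewrite scale0r addr0.
rewrite -[x in is_derive x](addr0 x) -(scale0r v).
apply: (is_derive_lineP _ x v 0 _).2.
apply: (@is_derive1_comp _ g (fun h : R => f (x + h *: v))).
by rewrite scale0r addr0.
Qed.

Lemma is_derive_scalev (V : normedModType R) (f : V -> R) (x v : V) (k l : R) :
  is_derive x v f l -> is_derive x (k *: v) f (k * l).
Proof.
move=> df.
have df0 : is_derive (k * 0 : R) 1 (fun h : R => f (x + h *: v)) l.
  by apply: (is_derive_lineP f x v (k * 0) l).1; rewrite mulr0 scale0r addr0.
rewrite -[x in is_derive x](addr0 x) -(scale0r (k *: v)).
apply: (is_derive_lineP _ x (k *: v) 0 _).2.
have -> : (fun h : R => f (x + h *: (k *: v))) =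
    (fun h : R => f (x + h *: v)) \o (fun h => k * h).
  by apply/funext => h /=; rewrite scalerA mulrC.
rewrite mulrC; apply: is_derive1_comp.
have := is_deriveZ k (is_derive_id (0 : R) 1).
by rewrite [k *: 1]mulr1.
Qed.

(** The point [0] is left out of the derivative hypothesis so that the lemma can serve to establish
    derivability there. *)
Lemma MVT_from0 (f f1 : R -> R) (h : R) :
  (forall x : R, x != 0 -> `|x| < `|h| -> is_derive x 1 f (f1 x)) ->
  {within [set x | `|x| <= `|h|], continuous f} ->
  exists2 c, `|c| <= `|h| & f h - f 0 = h * f1 c.
Proof.
move=> df cf; have [h0|h0|->] := ltrgtP h 0; last first.
- by exists 0 => //; rewrite mul0r subrr.
- have [||c] := @MVT _ f f1 0 h h0.
  + move=> x; rewrite in_itv/= => /andP[x0 xh]; apply: df.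
      by rewrite gt_eqF.
    by rewrite !gtr0_norm.
  + apply: continuous_subspaceW cf => x /=; rewrite in_itv/= => /andP[x0 xh].
    by rewrite ger0_norm// gtr0_norm.
  rewrite in_itv/= => /andP[c0 ch] E; exists c.
    by rewrite !gtr0_norm// ltW.
  by rewrite E subr0 mulrC.
- have [||c] := @MVT _ f f1 h 0 h0.
  + move=> x; rewrite in_itv/= => /andP[x0 xh]; apply: df.
      by rewrite lt_eqF.
    by rewrite !ltr0_norm// ltrN2.
  + apply: continuous_subspaceW cf => x /=; rewrite in_itv/= => /andP[x0 xh].
    by rewrite ler0_norm// ltr0_norm// lerN2.
  rewrite in_itv/= => /andP[c0 ch] E; exists c.
    by rewrite !ltr0_norm// lerN2 ltW.
  by move: E; lra.
Qed.

Lemma is_derive_C1_at0 (f f1 : R -> R) :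
  continuous f -> continuous f1 -> (forall x : R, x != 0 ->
    is_derive x 1 f (f1 x)) ->
  is_derive (0 : R) 1 f (f1 0).
Proof.
move=> cf cf1 df; apply/is_deriveP => e e0.
have /cvgrPdist_lt /(_ e e0) [d /= d0 fd] := cf1 0.
exists d => // h; rewrite /= /ball_ /= sub0r normrN => hd hn0.
have [||c ch E] := @MVT_from0 f f1 h.
- by move=> x xn0 _; exact: df.
- exact: continuous_subspaceT.
rewrite add0r [h *: 1]mulr1 E mulKf//; apply: fd => /=.
by rewrite /ball_/= sub0r normrN; exact: le_lt_trans hd.
Qed.

(** The point [x + h *: (a + b)] is reached first along [a], where the derivative at [x] applies,
    then along [b], where the mean value theorem and the continuity of [gb] apply. *)
Lemma is_derive_addv (V : normedModType R) (f gb : V -> R) (x a b : V) (l : R) :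
  is_derive x a f l -> (\forall y \near x, is_derive y b f (gb y)) ->
  {for x, continuous gb} -> is_derive x (a + b) f (l + gb x).
Proof.
move=> /is_deriveP da db cb; apply/is_deriveP => e e0.
have e20 : 0 < e / 2 by rewrite divr_gt0.
have {}da := da _ e20.
have /cvgrPdist_lt /(_ _ e20) {}cb := cb.
have [r /= r0 Hr] := (nbhs_ballP x _).1 (filterI db cb).
have s0 : 0 < `|a| + `|b| + 1 by rewrite ltr_wpDl// addr_ge0.
have small : \forall h \near (0 : R), `|h| < r / (`|a| + `|b| + 1).
  by apply: nbhs0_lt; exact: divr_gt0.
near=> h => hn0.
have inr (c : R) : `|c| <= `|h| -> ball x r (x + h *: a + c *: b).
  move=> ch; rewrite -ball_normE /= opprD addrA opprD addrA subrr sub0r.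
  rewrite -opprD normrN; apply: le_lt_trans (ler_normD _ _) _; rewrite !normrZ.
  have hr : `|h| * (`|a| + `|b| + 1) < r.
    rewrite -ltr_pdivlMr//; near: h; exact: small.
  apply: le_lt_trans hr; rewrite !mulrDr mulr1.
  apply: ler_wpDr => //; apply: lerD => //; exact: ler_wpM2r.
pose psi t := f (x + h *: a + t *: b).
have dpsi (t : R) : `|t| <= `|h| ->
  is_derive t 1 psi (gb (x + h *: a + t *: b)).
  by move=> th; apply: (is_derive_lineP f _ b t _).1;
    have [] := Hr _ (inr _ th).
have [||c ch E] := @MVT_from0 psi (fun t => gb (x + h *: a + t *: b)) h.
- by move=> t _ /ltW; exact: dpsi.
- apply: continuous_in_subspaceT => t /set_mem /= th.
  apply/differentiable_continuous/derivable1_diffP.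
  by have [] := dpsi t th.
have [_ /= G] := Hr _ (inr _ ch).
have D : `|l - h^-1 * (f (x + h *: a) - f x)| < e / 2.
  by move: hn0; near: h.
have -> : f (x + h *: (a + b)) - f x = (psi h - psi 0) + (f (x + h *: a) - f x).
  by rewrite /psi scale0r addr0 scalerDr addrA; ring.
rewrite E mulrDr mulKf//.
move: G D; rewrite !ltr_norml; lra.
Unshelve. all: by end_near. Qed.

(** Coordinates are added one at a time by [is_derive_addv], so continuous partial derivatives yield
    every directional derivative without a total differential. *)
Lemma is_derive_row (n : nat) (f : 'rV[R]_n -> R) (g : 'I_n -> 'rV[R]_n -> R)
    (x v : 'rV[R]_n) :
  (forall i, \forall y \near x, is_derive y (delta_mx 0 i) f (g i y)) ->
  (forall i, {for x, continuous (g i)}) ->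
  is_derive x v f (\sum_i v 0 i * g i x).
Proof.
move=> df cg.
have -> : v = \sum_i v 0 i *: delta_mx 0 i.
  by rewrite {1}[v]matrix_sum_delta big_ord1.
rewrite (eq_bigr (fun i => v 0 i * g i x)); last first.
  move=> i _; congr (_ * _); rewrite summxE (bigD1 i)//= !mxE !eqxx mulr1 big1
    ?addr0//.
  by move=> j ji; rewrite !mxE eqxx/= eq_sym (negPf ji) mulr0.
elim: (index_enum _) => [|i s IHs]; first by rewrite !big_nil;
  exact: is_derive0.
rewrite !big_cons addrC [X in is_derive _ _ _ X]addrC.
apply: (@is_derive_addv _ f (fun y => v 0 i * g i y)) => //.
- by move: (df i); apply: filterS => y dy; exact: is_derive_scalev.
- exact: (cvgM (cvg_cst (v 0 i)) (cg i)).
Qed.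

End Derivatives.

(** * One-sided calculus and the extension of [gamma] to the whole line *)

Section HalfLine.
Context {R : realType}.

(** By the mean value theorem the quotient is a value of [f1] between [0] and [h]. *)
Lemma right_quotient (f f1 : R -> R) (r : R) :
  0 < r -> (forall h : R, 0 < h < r -> is_derive h 1 f (f1 h)) ->
  {within `[0, r], continuous f} -> {within `[0, r], continuous f1} ->
  forall e : R, 0 < e -> exists2 d, 0 < d <= r &
    forall h, 0 < h <= d -> `|f1 0 - h^-1 * (f h - f 0)| < e.
Proof.
move=> r0 df cf /within_continuousP cf1 e e0.
have z0 : `[0, r]%classic 0 by rewrite /= in_itv/= lexx ltW.
have [d /= d0 Hd] := (nbhs_ballP _ _).1 (cf1 0 z0 e e0).
exists (Num.min (d / 2) r);
  first by rewrite lt_min r0 divr_gt0//= ge_min lexx orbT.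
move=> h; rewrite le_min => /andP[h0 /andP[hd hr]].
have [||c] := @MVT _ f f1 0 h h0.
- move=> x; rewrite in_itv/= => /andP[x0 xh]; apply: df.
  by rewrite x0 (lt_le_trans xh).
- apply: continuous_subspaceW cf => x /=; rewrite !in_itv/= => /andP[-> xh].
  exact: le_trans hr.
rewrite in_itv/= => /andP[c0 ch] ->; rewrite subr0 mulrCA mulVf ?gt_eqF// mulr1.
apply: Hd; last by rewrite /= in_itv/= !ltW// (lt_le_trans ch).
by rewrite /ball/= sub0r normrN gtr0_norm// (lt_le_trans ch)// (le_trans hd)//;
  lra.
Qed.

(** If [f2 0] were positive, [f1] would be positive just to the right of [0], and [f] would exceed
    [f 0] there. *)
Lemma second_derivative_le0 (f f1 f2 : R -> R) (r : R) :
  0 < r -> (forall h : R, 0 < h < r -> is_derive h 1 f (f1 h)) ->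
  (forall h : R, 0 < h < r -> is_derive h 1 f1 (f2 h)) ->
  {within `[0, r], continuous f} -> {within `[0, r], continuous f1} ->
  {within `[0, r], continuous f2} ->
  (forall h, 0 < h <= r -> f h <= f 0) -> f1 0 = 0 -> f2 0 <= 0.
Proof.
move=> r0 df df1 cf cf1 cf2 fmax f10; rewrite leNgt; apply/negP => f20.
(* [f2 0] itself serves as tolerance, which makes the quotients [f1 c / c] positive. *)
have [d /andP[d0 dr] Hd] := right_quotient r0 df1 cf1 cf2 f20.
have [||c] := @MVT _ f f1 0 d d0.
- move=> x; rewrite in_itv/= => /andP[x0 xh]; apply: df.
  by rewrite x0 (lt_le_trans xh).
- apply: continuous_subspaceW cf => x /=; rewrite !in_itv/= => /andP[-> xh].
  exact: le_trans dr.
rewrite in_itv/= => /andP[c0 cd]; have := fmax d; rewrite d0 dr => /(_ isT).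
have : `|f2 0 - c^-1 * (f1 c - f1 0)| < f2 0 by apply: Hd; rewrite c0 ltW.
rewrite f10 subr0 ltr_norml => /andP[_];
  rewrite ltrBlDr ltrDl pmulr_rgt0 ?invr_gt0//.
move=> f1c fd E; have : 0 < f1 c * (d - 0) by rewrite mulr_gt0// subr0.
by rewrite -E; lra.
Qed.

(* [P] continues [f - f 0] to the negative half-line. *)
Lemma halfline_extension (f f1 P P1 : R -> R) :
  {within [set s : R | 0 <= s], continuous f} ->
  {within [set s : R | 0 <= s], continuous f1} ->
  (forall s : R, 0 < s -> is_derive s 1 f (f1 s)) ->
  continuous P1 -> (forall s : R, is_derive s 1 P (f1 0 + P1 s)) ->
  P 0 = 0 -> P1 0 = 0 ->
  forall s : R, is_derive s 1 (fun s : R => f (Num.max 0 s) + P (Num.min 0 s))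
    (f1 (Num.max 0 s) + P1 (Num.min 0 s)).
Proof.
move=> cf cf1 df cP1 dP P0 P10.
have cP : continuous P.
  by move=> s; apply/differentiable_continuous/derivable1_diffP;
    have [] := dP s.
have cmax : continuous (fun s : R => Num.max 0 s).
  by move=> s; apply: continuous_max => //; exact: cvg_cst.
have cmin : continuous (fun s : R => Num.min 0 s).
  by move=> s; apply: continuous_min => //; exact: cvg_cst.
have ext (g Q : R -> R) : {within [set s : R | 0 <= s], continuous g} ->
  continuous Q ->
    continuous (fun s : R => g (Num.max 0 s) + Q (Num.min 0 s)).
  move=> cg cQ s; apply: cvgD; last first.
    by apply: (@continuous_comp _ _ _ (fun s : R => Num.min 0 s) Q);
      [exact: cmin|exact: cQ].
  suff cgm : continuous (g \o (fun s : R => Num.max 0 s)) by exact: cgm.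
  apply/continuous_subspace_setT; apply: within_continuous_compose cg.
    exact: continuous_subspaceT.
  by move=> x _ /=; rewrite le_max lexx.
have dn0 (x : R) : x != 0 ->
    is_derive x 1 (fun s : R => f (Num.max 0 s) + P (Num.min 0 s))
    (f1 (Num.max 0 x) + P1 (Num.min 0 x)).
  rewrite neq_lt => /orP[x0|x0].
    rewrite max_l ?min_r ?ltW//.
    apply: (@near_eq_is_derive _ _ _ (fun s => f 0 + P s)).
      near=> t; have t0 : t <= 0 by apply/ltW; near: t; exact: lt_nbhsl.
      by rewrite max_l ?min_r.
    rewrite -[X in is_derive _ _ _ X]add0r.
    exact: (is_deriveD (is_derive_cst (f 0) x 1) (dP x)).
  rewrite max_r ?min_l ?ltW// P10 addr0.
  apply: (@near_eq_is_derive _ _ _ f); last exact: df.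
  near=> t; have t0 : 0 <= t by apply/ltW; near: t; exact: lt_nbhsr.
  by rewrite max_r ?min_l// P0 addr0.
(* At the junction [0] the derivative is the common limit of the derivatives on both sides. *)
move=> s; have [->|] := eqVneq s 0; last exact: dn0.
by apply: (@is_derive_C1_at0 _ _ (fun s =>
  f1 (Num.max 0 s) + P1 (Num.min 0 s)));
  exact: ext.
Unshelve. all: by end_near. Qed.

(** The values of [gamma] at negative reals are arbitrary, so they are replaced by its second-order
    Taylor polynomial at [0]. The result is C^2 on the whole line, and the chain rule applies even
    where [v] vanishes. *)
Lemma C3_halfline_extension (gamma : R -> R) : C3_halfline gamma ->
  exists G G1 G2 : R -> R, [/\ forall s, 0 <= s -> G s = gamma s,
    forall s : R, is_derive s 1 G (G1 s),
    forall s : R, is_derive s 1 G1 (G2 s) & continuous G2].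
Proof.
move=> [c0 H].
have [//|d0 [g1 [c1 E1]]] := H 0%N.
have [//|d1 [g2 [c2 E2]]] := H 1%N.
have D0 (s : R) : 0 < s -> is_derive s 1 gamma (g1 s).
  move=> s0; rewrite -(E1 _ s0); split; first exact: d0.
  exact: (esym (derive1E _ _)).
have D1 (s : R) : 0 < s -> is_derive s 1 g1 (g2 s).
  move=> s0; apply: (@near_eq_is_derive _ _ _ (gamma^`(1))%classic).
    near=> t; have t0 : 0 < t by near: t; exact: lt_nbhsr.
    exact: E1 t t0.
  rewrite -(E2 _ s0); split; first exact: d1.
  exact: (esym (derive1E _ _)).
pose b := g1 0; pose d := g2 0.
(* For negative [s] the first term is frozen at [gamma 0]; for positive [s] the polynomial
   vanishes. *)
exists (fun s => gamma (Num.max 0 s)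
  + (b * Num.min 0 s + d / 2 * (Num.min 0 s * Num.min 0 s))).
exists (fun s => g1 (Num.max 0 s) + d * Num.min 0 s).
exists (fun s => g2 (Num.max 0 s) + 0).
have dm : continuous (fun s : R => d * s).
  by move=> s; apply: cvgM; [exact: cvg_cst|].
split.
- by move=> s s0; rewrite max_r ?min_l// !mulr0 !addr0.
- apply: (@halfline_extension gamma g1 (fun s =>
  b * s + d / 2 * (s * s)) (fun s => d * s)) => //.
  + move=> s; have := is_deriveD (is_deriveZ b (is_derive_id s 1))
      (is_deriveZ (d / 2) (is_deriveM (is_derive_id s 1) (is_derive_id s 1))).
    by congr is_derive; rewrite /GRing.scale/= -/b; field.
  + by rewrite /= !mulr0 addr0.
  + by rewrite /= mulr0.
- apply: (@halfline_extension g1 g2 (fun s => d * s) (fun=> 0)) => //.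
  + by move=> s; exact: cvg_cst.
  + move=> s; have := is_deriveZ d (is_derive_id s 1).
    by congr is_derive; rewrite addr0 [LHS]mulr1.
  + by rewrite /= mulr0.
- move=> s; apply: cvgD; last exact: cvg_cst.
  have cmax : continuous (fun s : R => Num.max 0 s).
    by move=> t; apply: continuous_max => //; exact: cvg_cst.
  suff cgm : continuous (g2 \o (fun s : R => Num.max 0 s)) by exact: cgm.
  apply/continuous_subspace_setT; apply: within_continuous_compose c2.
    exact: continuous_subspaceT.
  by move=> x _ /=; rewrite le_max lexx.
Unshelve. all: by end_near. Qed.

End HalfLine.

(** * Functions of class C^2 up to the boundary, and rays into the domain *)

Section Jets.
Context {R : realType} {n : nat}.
Implicit Types (Omega : set 'rV[R]_n) (z : 'rV[R]_n -> R) (x e : 'rV[R]_n)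
  (g : 'I_n -> 'rV[R]_n -> R) (H : 'I_n -> 'I_n -> 'rV[R]_n -> R).

(* [partial i z] is junk on the boundary, hence the derivatives are carried
   along as functions continuous on the closure. *)
Definition C2_jet Omega z g H :=
  [/\ {within closure Omega, continuous z},
      forall i, {within closure Omega, continuous (g i)},
      forall i j, {within closure Omega, continuous (H i j)},
      forall x, Omega x -> forall i, is_derive x (delta_mx 0 i) z (g i x) &
      forall x, Omega x -> forall i j, is_derive x (delta_mx 0 j) (g i)
        (H i j x)].

(** Being pointwise and linear in the extended gradient, this form of the Neumann condition passes
    to products and compositions by algebra alone. *)
Definition neumann_jet Omega g := forall x nu, bdry Omega x ->
  outward_normal Omega x nu -> \sum_i nu 0 i * g i x = 0.

Lemma C2_jet_exists Omega z : open Omega ->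
  {within closure Omega, continuous z} ->
  (forall i, (forall x, Omega x -> derivable z x (delta_mx 0 i)) /\
     continuous_up_to Omega (closure Omega) (partial i z)) ->
  (forall i j, (forall x, Omega x ->
    derivable (partial i z) x (delta_mx 0 j)) /\
     continuous_up_to Omega (closure Omega) (partial j (partial i z))) ->
  exists g H, C2_jet Omega z g H.
Proof.
move=> oO cz d1 d2.
have [g Hg] := choice (fun i => (d1 i).2).
have [H HH] := choice (fun ij : 'I_n * 'I_n => (d2 ij.1 ij.2).2).
exists g, (fun i j => H (i, j)); split => //.
- by move=> i; have [] := Hg i.
- by move=> i j; have [] := HH (i, j).
- move=> x Ox i; have [_ <- //] := Hg i; split => //.
  by have [+ _] := d1 i; apply.
(* [g i] is known to equal [partial i z] only in [Omega]; openness makes the equality hold near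
   [x]. *)
- move=> x Ox i j; apply: (@near_eq_is_derive _ _ _ (partial i z)).
    by near=> y; have [_ -> //] := Hg i; near: y; exact: open_nbhs_nbhs.
  have [_ <- //] := HH (i, j); split => //.
  by have [+ _] := d2 i j; apply.
Unshelve. all: by end_near. Qed.

Lemma C2_closure_jet Omega z : open Omega -> C2_closure Omega z ->
  exists g H, C2_jet Omega z g H.
Proof.
move=> oO [cz [_ H]]; apply: C2_jet_exists => // [i|i j].
  by have [d [c _]] := H i.
by have [d [_ /(_ j) [d2 [c2 _]]]] := H i.
Qed.

Lemma C2_jet_laplacian Omega z g H x : open Omega -> C2_jet Omega z g H ->
  Omega x -> laplacian z x = \sum_i H i i x.
Proof.
move=> oO [_ _ _ d1 d2] Ox; apply: eq_bigr => i _; rewrite [in LHS]/partial.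
have <- := @derive_val _ _ _ _ _ _ _ (d2 _ Ox i i).
apply: near_eq_derive; near=> y; rewrite /partial.
apply: (@derive_val _ _ _ _ _ _ _ (d1 y _ i)).
by near: y; exact: open_nbhs_nbhs.
Unshelve. all: by end_near. Qed.

Lemma interior_continuous Omega z x : open Omega ->
  {within closure Omega, continuous z} ->
  Omega x -> {for x, continuous z}.
Proof.
move=> oO cz Ox; have := continuous_subspaceW (@subset_closure _ Omega) cz.
by rewrite continuous_open_subspace// => /(_ x); apply; exact/mem_set.
Qed.

Lemma is_derive_jet Omega z g x e : open Omega ->
  (forall i, {within closure Omega, continuous (g i)}) ->
  (forall x, Omega x -> forall i, is_derive x (delta_mx 0 i) z (g i x)) ->
  Omega x -> is_derive x e z (\sum_i e 0 i * g i x).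
Proof.
move=> oO cg d Ox; apply: is_derive_row => i;
  last exact: interior_continuous (cg i) Ox.
by near=> y; apply: d; near: y; exact: open_nbhs_nbhs.
Unshelve. all: by end_near. Qed.

(** Rays into [Omega] allow the same one-sided calculus at interior and at boundary points. *)
Definition inward Omega x e := exists2 r : R, 0 < r & forall h, 0 < h <= r ->
  Omega (x + h *: e).

Lemma inward_ray_continuous Omega x e (r : R) z : closure Omega x ->
  (forall h, 0 < h <= r -> Omega (x + h *: e)) ->
  {within closure Omega, continuous z} ->
  {within `[0, r], continuous (fun h : R => z (x + h *: e))}.
Proof.
move=> clx inO cz.
apply: (@within_continuous_compose _ _ _ _ (closure Omega)
  (fun h : R => x + h *: e) z) => //.
  apply: continuous_subspaceT => h; apply: cvgD; first exact: cvg_cst.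
  by apply: cvgZr_tmp; exact: cvg_id.
move=> h /=; rewrite in_itv/= le_eqVlt => /andP[/orP[/eqP <-|h0] hr].
  by rewrite scale0r addr0.
by apply/subset_closure/inO; rewrite h0.
Qed.

Lemma inward_ray_derive Omega x e (r : R) z g : open Omega ->
  (forall h, 0 < h <= r -> Omega (x + h *: e)) ->
  (forall i, {within closure Omega, continuous (g i)}) ->
  (forall x, Omega x -> forall i, is_derive x (delta_mx 0 i) z (g i x)) ->
  forall h : R, 0 < h < r -> is_derive h 1 (fun h : R => z (x + h *: e))
    (\sum_i e 0 i * g i (x + h *: e)).
Proof.
move=> oO inO cg d h /andP[h0 hr]; apply: (is_derive_lineP z x e h _).1.
by apply: is_derive_jet => //; apply: inO; rewrite h0 ltW.
Qed.

(** On the ray the extended gradient gives the derivative for [h > 0] and is continuous down to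
    [h = 0], so [right_quotient] applies even at a boundary point. *)
Lemma inward_quotient Omega z g H x e : open Omega -> closure Omega x ->
  C2_jet Omega z g H -> inward Omega x e ->
  forall d : R, 0 < d -> exists2 s, 0 < s & forall h, 0 < h <= s ->
    `|\sum_i e 0 i * g i x - h^-1 * (z (x + h *: e) - z x)| < d.
Proof.
move=> oO clx [cz cg _ d1 _] [r r0 inO] d d0.
have [|||s /andP[s0 sr] Hs] := @right_quotient _ (fun h : R => z (x + h *: e))
  (fun h => \sum_i e 0 i * g i (x + h *: e)) r r0 _ _ _ d d0.
- exact: (inward_ray_derive oO inO cg d1).
- exact: (inward_ray_continuous clx inO cz).
- apply: within_continuous_sum => i; apply: within_continuousM.
    exact: within_continuous_cst.
  exact: (inward_ray_continuous clx inO (cg i)).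
by exists s => // h /Hs; rewrite !scale0r !addr0.
Qed.

Lemma inward_max_gradient Omega z g H x e : open Omega -> closure Omega x ->
  C2_jet Omega z g H -> inward Omega x e ->
  (forall y, closure Omega y -> z y <= z x) -> \sum_i e 0 i * g i x <= 0.
Proof.
move=> oO clx J [r r0 inO] zmax; rewrite leNgt; apply/negP => pos.
have iO : inward Omega x e by exists r.
have [s s0 Hs] := inward_quotient oO clx J iO pos.
pose h := Num.min r s.
have h0 : 0 < h by rewrite lt_min r0.
have /Hs : 0 < h <= s by rewrite h0 ge_min lexx orbT.
rewrite ltr_norml => /andP[_].
rewrite ltrBlDr ltrDl pmulr_rgt0 ?invr_gt0// subr_gt0 ltNge zmax//.
by apply/subset_closure/inO; rewrite h0 ge_min lexx.
Qed.

(** Along the ray this is the second-derivative test in one variable; the vanishing gradient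
    provides its first-order condition. *)
Lemma inward_max_hessian Omega z g H x e : open Omega -> closure Omega x ->
  C2_jet Omega z g H -> inward Omega x e ->
  (forall y, closure Omega y -> z y <= z x) -> (forall i, g i x = 0) ->
  \sum_i e 0 i * (\sum_j e 0 j * H i j x) <= 0.
Proof.
move=> oO clx [cz cg cH d1 d2] [r r0 inO] zmax gx0.
have := @second_derivative_le0 _ (fun h : R => z (x + h *: e))
  (fun h => \sum_i e 0 i * g i (x + h *: e))
  (fun h => \sum_i e 0 i * (\sum_j e 0 j * H i j (x + h *: e))) r r0.
rewrite !scale0r !addr0; apply.
- exact: (inward_ray_derive oO inO cg d1).
- move=> h hr.
  have -> : (fun h : R => \sum_i e 0 i * g i (x + h *: e)) =
      \sum_i e 0 i *: (fun h : R => g i (x + h *: e)).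
    by apply/funext => k; rewrite fct_sumE.
  apply: is_derive_sum => i; apply: is_deriveZ.
  apply: (inward_ray_derive oO inO (cH i)) => //.
  by move=> y Oy j; exact: d2.
- exact: (inward_ray_continuous clx inO cz).
- apply: within_continuous_sum => i; apply: within_continuousM.
    exact: within_continuous_cst.
  exact: (inward_ray_continuous clx inO (cg i)).
- apply: within_continuous_sum => i; apply: within_continuousM.
    exact: within_continuous_cst.
  apply: within_continuous_sum => j; apply: within_continuousM.
    exact: within_continuous_cst.
  exact: (inward_ray_continuous clx inO (cH i j)).
- by move=> h hr; apply/zmax/subset_closure/inO.
- by rewrite big1// => i _; rewrite gx0 mulr0.
Qed.

Lemma inward_interior Omega x e : open Omega -> Omega x -> inward Omega x e.
Proof.
move=> oO Ox.
have : \forall h \near (0 : R), Omega (x + h *: e).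
  have c : {for (0 : R), continuous (fun h : R => x + h *: e)}.
    apply: cvgD; first exact: cvg_cst.
    by apply: cvgZr_tmp; exact: cvg_id.
  by apply: c; rewrite scale0r addr0; exact: open_nbhs_nbhs.
move=> /nbhs_ballP[r /= r0 Hr]; exists (r / 2); first by rewrite divr_gt0.
move=> h /andP[h0 hr]; apply: Hr.
by rewrite /ball/= sub0r normrN gtr0_norm//; lra.
Qed.

(** [rho] is at most [0] at [x] and strictly decreases to first order along [e], so it is negative
    on a short initial piece of the ray. *)
Lemma inward_boundary Omega x e U rho : closure Omega x ->
  local_defining_function Omega x U rho ->
  \sum_i e 0 i * grad rho x 0 i < 0 -> inward Omega x e.
Proof.
move=> clx [oU Ux /(_ 1%N) [[r0 [cr0 Er0]] r1] _ OU] en.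
have cU f : continuous_up_to U U f -> forall y, U y -> {for y, continuous f}.
  move=> [f' [cf' Ef]] y Uy.
  have : {within U, continuous f}.
    by apply: subspace_eq_continuous cf' => u /set_mem Uu; apply: esym;
      exact: Ef.
  by rewrite continuous_open_subspace// => /(_ y); apply; exact/mem_set.
have crho : {for x, continuous rho} by apply: cU Ux; exists r0.
have rx : rho x <= 0.
  rewrite leNgt; apply/negP => rx.
  have : \forall y \near x, U y /\ 0 < rho y.
    near=> y; split; near: y; first exact: open_nbhs_nbhs.
    exact: (cvgr_gt _ crho).
  move=> /clx [y [Oy [Uy ry]]].
  have : (Omega `&` U) y by [].
  by rewrite OU => -[/=]; rewrite ltNge ltW.
have drho : is_derive x e rho (\sum_i e 0 i * partial i rho x).
  apply: (@is_derive_row _ _ rho (fun i => partial i rho)) => i.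
    have dU y : U y -> is_derive y (delta_mx 0 i) rho (partial i rho y).
      by move=> Uy; split => //; have [+ _] := r1 i; apply.
    by near=> y; apply: dU; near: y; exact: open_nbhs_nbhs.
  by have [_ [c _]] := r1 i; exact: cU.
have l0 : 0 < - \sum_i e 0 i * partial i rho x.
  rewrite oppr_gt0; move: en; congr (_ < _); apply: eq_bigr => i _.
  by rewrite mxE.
have Hd := (is_deriveP _ _ _ _).1 drho _ l0.
have [rU rU0 HU] := inward_interior e oU Ux.
have [d /= d0 {}Hd] := (nbhs_ballP _ _).1 Hd.
exists (Num.min rU (d / 2)); first by rewrite lt_min rU0 divr_gt0.
move=> h; rewrite le_min => /andP[h0 /andP[hU hd]].
have Uh : U (x + h *: e) by apply: HU; rewrite h0.
suff : (Omega `&` U) (x + h *: e) by case.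
rewrite OU; split => //=; apply: lt_le_trans rx.
have : ball (0 : R) d h by rewrite /ball/= sub0r normrN gtr0_norm//; lra.
move=> /Hd; rewrite gt_eqF// => /(_ isT); rewrite ltr_norml => /andP[+ _].
set q := h^-1 * _ => Hq; have q0 : q < 0 by lra.
by rewrite -subr_lt0 -(pmulr_rlt0 _ (_ : 0 < h^-1)) ?invr_gt0.
Unshelve. all: by end_near. Qed.

Lemma sum_sqr_eq0 (a : 'I_n -> R) : \sum_i a i * a i <= 0 -> forall i, a i = 0.
Proof.
move=> H i; have : \sum_i a i * a i == 0.
  by rewrite eq_le H sumr_ge0// => j _; rewrite -expr2 sqr_ge0.
rewrite psumr_eq0; last by move=> j _; rewrite -expr2 sqr_ge0.
by move=> /allP /(_ i); rewrite mem_index_enum mulf_eq0 orbb => /(_ isT) /eqP.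
Qed.

End Jets.

(** * Maximum principle under Neumann conditions *)

Section MaximumPrinciple.
Context {R : realType} {n : nat}.
Implicit Types (Omega : set 'rV[R]_n) (z : 'rV[R]_n -> R) (x e : 'rV[R]_n)
  (g : 'I_n -> 'rV[R]_n -> R) (H : 'I_n -> 'I_n -> 'rV[R]_n -> R).

Lemma sum_sqr_gt0 (v : 'rV[R]_n) : v != 0 -> 0 < \sum_i v 0 i * v 0 i.
Proof.
move=> v0; rewrite ltNge; apply: contra v0 => /sum_sqr_eq0 v0.
by apply/eqP/rowP => i; rewrite v0 mxE.
Qed.

Lemma sum_delta_row (i : 'I_n) (a : 'I_n -> R) :
  \sum_k (delta_mx 0 i : 'rV[R]_n) 0 k * a k = a i.
Proof.
rewrite (bigD1 i)//= big1 => [|j ji]; first by rewrite mxE !eqxx mul1r addr0.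
by rewrite mxE (negPf ji) mul0r.
Qed.

Lemma outward_normal_scale Omega x nu : outward_normal Omega x nu ->
  exists U rho, local_defining_function Omega x U rho /\
    exists2 c : R, 0 < c & nu = c *: grad rho x.
Proof.
move=> [U [rho [loc ->]]]; exists U, rho; split => //.
have [_ _ _ g0 _] := loc.
exists (norm2 (grad rho x))^-1 => //; rewrite invr_gt0 sqrtr_gt0.
by under eq_bigr do rewrite expr2; exact: sum_sqr_gt0.
Qed.

(** Along the inward direction [- nu] the difference quotient tends to minus the normal component of
    [g] by the jet, and to [0] by the Neumann condition. *)
Lemma neumann_jetP Omega z g H : open Omega -> C2_jet Omega z g H ->
  neumann Omega z -> neumann_jet Omega g.
Proof.
move=> oO J Nz x nu bx nux; have [clx _] := bx.
have [U [rho [loc [c c0 Enu]]]] := outward_normal_scale nux.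
have inw : inward Omega x (- nu).
  apply: (inward_boundary clx loc).
  rewrite (eq_bigr (fun i => - c * (grad rho x 0 i * grad rho x 0 i)));
    last first.
    by move=> i _; rewrite Enu !mxE; ring.
  rewrite -mulr_sumr mulNr oppr_lt0 mulr_gt0// sum_sqr_gt0//.
  by have [] := loc.
apply/eqP/contraT => S0; set S := \sum_i _ in S0.
(* Two errors below half of the absolute value of [S] will contradict [S != 0]. *)
have d0 : 0 < `|S| / 2 by rewrite divr_gt0// normr_gt0.
have [s s0 Hs] := inward_quotient oO clx J inw d0.
have /cvgrPdist_lt /(_ _ d0) := Nz x nu bx nux.
rewrite near_withinE => /nbhs_ballP[r /= r0 Hr].
pose h := Num.min s (r / 2).
have h0 : 0 < h by rewrite lt_min s0 divr_gt0.
have hr : h < r.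
  by apply: (@le_lt_trans _ _ (r / 2)); [rewrite ge_min lexx orbT|lra].
have /Hr /(_ h0) : ball (0 : R) r h by rewrite /ball/= sub0r normrN gtr0_norm.
have /Hs : 0 < h <= s by rewrite h0 ge_min lexx.
rewrite (eq_bigr (fun i => - (nu 0 i * g i x))); last by move=> i _;
  rewrite mxE mulNr.
rewrite sumrN -/S scalerN sub0r normrN => A B.
have : `|S| < `|S|.
  set q := h^-1 * (z x - _) in B.
  have E : h^-1 * (z (x - h *: nu) - z x) = - q by rewrite /q; ring.
  rewrite E opprK in A; have := ltrD A B; rewrite -splitr; apply: le_lt_trans.
  have -> : `|S| = `|(- S + q) - q| by rewrite addrK normrN.
  exact: ler_normB.
by rewrite ltxx.
Qed.

Lemma quadratic_le0 (a b c : R) : (forall s, 0 < s ->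
  a - s * b + s ^+ 2 * c <= 0) -> a <= 0.
Proof.
move=> Hs; rewrite leNgt; apply/negP => a0.
pose k := `|b| + `|c| + 1; have k0 : 0 < k by rewrite ltr_wpDl// addr_ge0.
(* The bound [s <= 1] lets [s] dominate [s ^+ 2]; the other one keeps both perturbations together
   within [a / 2]. *)
pose s := Num.min 1 (a / (2 * k)).
have s0 : 0 < s by rewrite lt_min ltr01 divr_gt0// mulr_gt0.
have s1 : s <= 1 by rewrite ge_min lexx.
have sk : s * k <= a / 2.
  rewrite -ler_pdivlMr//; have -> : a / 2 / k = a / (2 * k) by field;
    rewrite gt_eqF.
  by rewrite ge_min lexx orbT.
have sb : s * b <= s * `|b| by rewrite ler_wpM2l ?ler_norm// ltW.
have sc : - (s ^+ 2 * c) <= s * `|c|.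
  rewrite -mulrN; apply: (@le_trans _ _ (s ^+ 2 * `|c|)).
    apply: ler_wpM2l; first by rewrite exprn_ge0// ltW.
    by rewrite -(normrN c) ler_norm.
  by rewrite ler_wpM2r// expr2 ler_piMl// ltW.
have := Hs s s0; move: sk; rewrite /k !mulrDr mulr1; lra.
Qed.

(* At a boundary maximum the gradient vanishes by the Neumann condition, so the
   Hessian is nonpositive on inward directions, and these together with their
   opposites are dense. *)
Lemma max_hessian_diag Omega z g H x : smooth_bounded_domain Omega ->
  C2_jet Omega z g H -> neumann_jet Omega g -> closure Omega x ->
  (forall y, closure Omega y -> z y <= z x) -> forall i, H i i x <= 0.
Proof.
move=> [_ oO _ _ bO] J Ng clx zmax i.
have [Ox|nOx] := pselect (Omega x).
  have inw e := inward_interior e oO Ox.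
  have g0 : forall j, g j x = 0.
    apply: sum_sqr_eq0.
    have := inward_max_gradient oO clx J (inw (\row_j g j x)) zmax.
    by under eq_bigr do rewrite mxE.
  have := inward_max_hessian oO clx J (inw (delta_mx 0 i)) zmax g0.
  by rewrite !sum_delta_row.
have bx : bdry Omega x by [].
have [U [rho loc]] := bO x bx.
have [_ _ _ N0 _] := loc.
pose N := grad rho x; have NN := sum_sqr_gt0 N0; rewrite -/N in NN.
have Ng0 : \sum_i N 0 i * g i x = 0.
  have onu : outward_normal Omega x ((norm2 N)^-1 *: N) by exists U, rho.
  have := Ng _ _ bx onu.
  rewrite (eq_bigr (fun i => (norm2 N)^-1 * (N 0 i * g i x))); last first.
    by move=> j _; rewrite mxE mulrA.
  rewrite -mulr_sumr => /eqP; rewrite mulf_eq0 invr_eq0 => /orP[|/eqP//].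
  rewrite gt_eqF// sqrtr_gt0.
  by under eq_bigr do rewrite expr2.
have inw e : \sum_i e 0 i * N 0 i < 0 -> inward Omega x e.
  exact: inward_boundary loc.
have g0 : forall j, g j x = 0.
  apply: sum_sqr_eq0.
  (* As the gradient is orthogonal to [N], subtracting [N] makes its direction inward without
     changing the product with the gradient. *)
  have /inw inwe : \sum_i ((\row_j g j x) - N) 0 i * N 0 i < 0.
    rewrite (eq_bigr (fun i => N 0 i * g i x - N 0 i * N 0 i)); last first.
      by move=> j _; rewrite !mxE; ring.
    by rewrite sumrB Ng0 sub0r oppr_lt0.
  have := inward_max_gradient oO clx J inwe zmax.
  rewrite (eq_bigr (fun i => g i x * g i x - N 0 i * g i x)); last first.
    by move=> j _; rewrite !mxE; ring.
  by rewrite sumrB Ng0 subr0.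
(* The sign keeps [sg *: delta_mx 0 i] from pointing outward, and a small tilt by [- s *: N] makes
   it inward. Since [sg * sg = 1], the sign drops out of the leading term [H i i x]. *)
pose sg : R := if 0 <= N 0 i then -1 else 1.
have sgN : sg * N 0 i <= 0 by rewrite /sg; case: (leP 0 (N 0 i)) => ?; lra.
have sg2 : sg * sg = 1 by rewrite /sg; case: ifP => _; ring.
apply: (@quadratic_le0 _ (sg * (\sum_j N 0 j * H i j x)
  + sg * \sum_j N 0 j * H j i x)
  (\sum_k N 0 k * \sum_j N 0 j * H k j x)) => s s0.
pose e : 'rV[R]_n := sg *: delta_mx 0 i - s *: N.
have sumd (a : 'I_n -> R) :
  \sum_k e 0 k * a k = sg * a i - s * \sum_k N 0 k * a k.
  rewrite -[in RHS](sum_delta_row i a) !mulr_sumr -sumrB; apply: eq_bigr => k _.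
  by rewrite !mxE; ring.
have /inw inwe : \sum_k e 0 k * N 0 k < 0.
  rewrite sumd; have := mulr_gt0 s0 NN; move: sgN; lra.
have := inward_max_hessian oO clx J inwe zmax g0.
rewrite (eq_bigr (fun k => e 0 k * (sg * H k i x -
  s * \sum_j N 0 j * H k j x))); last first.
  by move=> k _; congr (_ * _); exact: sumd.
rewrite (sumd (fun k => sg * H k i x - s * \sum_j N 0 j * H k j x)).
have -> : \sum_k N 0 k * (sg * H k i x - s * \sum_j N 0 j * H k j x) =
    sg * (\sum_j N 0 j * H j i x) - s * \sum_k N 0 k * \sum_j N 0 j * H k j x.
  rewrite !mulr_sumr -sumrB; apply: eq_bigr => k _; ring.
rewrite mulrBr mulrA sg2; congr (_ <= _); ring.
Qed.

Lemma max_trace Omega z g H x : smooth_bounded_domain Omega ->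
  C2_jet Omega z g H -> neumann_jet Omega g -> closure Omega x ->
  (forall y, closure Omega y -> z y <= z x) -> \sum_i H i i x <= 0.
Proof.
move=> sO J Ng clx zmax; apply: sumr_le0 => i _.
exact: (max_hessian_diag sO J Ng clx zmax).
Qed.

Lemma compact_closure_domain Omega : smooth_bounded_domain Omega ->
  compact (closure Omega).
Proof.
move=> [_ _ _ bO _]; apply: bounded_closed_compact; last exact: closed_closure.
case: bO => M [Mr HM]; exists M; split => // N MN; have := HM N MN.
move=> HN x clx /=; rewrite leNgt; apply/negP => Nx.
have : \forall y \near x, N < `|y|.
  have /cvgr_gt : {for x, continuous (fun y : 'rV[R]_n => `|y|)} by exact:
    norm_continuous.
  exact.
by move=> /clx [y [Oy]]; rewrite ltNge => /negP; apply; exact: HN.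
Qed.

Lemma within_continuous_laplacian Omega z g H : C2_jet Omega z g H ->
  {within closure Omega, continuous (fun x => z x - \sum_i H i i x)}.
Proof.
move=> [cz _ cH _ _]; apply: within_continuousB => //.
exact: within_continuous_sum.
Qed.

(** At a maximum point the trace of the Hessian is nonpositive, so [z] is at most [z - Delta z]
    there, and the latter is bounded by [M] up to the boundary by continuity. *)
Lemma elliptic_comparison Omega z g H M : smooth_bounded_domain Omega ->
  C2_jet Omega z g H -> neumann_jet Omega g ->
  (forall x, Omega x -> z x - \sum_i H i i x <= M) ->
  forall x, closure Omega x -> z x <= M.
Proof.
move=> sO J Ng zM x clx; have [cz _ _ _ _] := J.
have [|c /set_mem clc cmax] := compact_EVT_max _ (compact_closure_domain sO) cz.
  by exists x.
have zmax y : closure Omega y -> z y <= z c by move=> /mem_set; exact: cmax.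
apply: (le_trans (zmax x clx)).
have := within_closure_le (within_continuous_laplacian J) zM clc.
have := max_trace sO J Ng clc zmax; lra.
Qed.

End MaximumPrinciple.

(** * Linear combinations, products and compositions of jets *)

Section JetAlgebra.
Context {R : realType} {n : nat}.
Context (Omega : set 'rV[R]_n).
Implicit Types (z : 'rV[R]_n -> R)
  (g : 'I_n -> 'rV[R]_n -> R) (H : 'I_n -> 'I_n -> 'rV[R]_n -> R).

Lemma within_continuous_lin (T : topologicalType) (A : set T) (a b : R)
    (f1 f2 : T -> R) :
  {within A, continuous f1} -> {within A, continuous f2} ->
  {within A, continuous (fun x => a * f1 x + b * f2 x)}.
Proof.
by move=> c1 c2; apply: within_continuousD;
  (apply: within_continuousM => //; exact: within_continuous_cst).
Qed.

(** This allows [gamma] to be exchanged with its extension to the whole line. *)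
Lemma C2_jet_ext z z' g H : open Omega -> (forall x, closure Omega x ->
  z x = z' x) ->
  C2_jet Omega z g H -> C2_jet Omega z' g H.
Proof.
move=> oO zz' [cz cg cH d1 d2]; split => //.
  by apply: subspace_eq_continuous cz => x /set_mem; exact: zz'.
move=> x Ox i; apply: near_eq_is_derive (d1 x Ox i).
by near=> y; apply/zz'/subset_closure; near: y; exact: open_nbhs_nbhs.
Unshelve. all: by end_near. Qed.

Lemma C2_jet_lin (a b : R) z1 g1 H1 z2 g2 H2 : C2_jet Omega z1 g1 H1 ->
  C2_jet Omega z2 g2 H2 ->
  C2_jet Omega (fun x => a * z1 x + b * z2 x)
    (fun i x => a * g1 i x + b * g2 i x)
    (fun i j x => a * H1 i j x + b * H2 i j x).
Proof.
have dl (f1 f2 : 'rV[R]_n -> R) l1 l2 (x e : 'rV[R]_n) :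
  is_derive x e f1 l1 -> is_derive x e f2 l2 ->
    is_derive x e (fun x => a * f1 x + b * f2 x) (a * l1 + b * l2).
  by move=> d1 d2; exact: (is_deriveD (is_deriveZ a d1) (is_deriveZ b d2)).
move=> [cz1 cg1 cH1 d1 dd1] [cz2 cg2 cH2 d2 dd2].
split=> *; by [apply: within_continuous_lin|apply: dl; auto].
Qed.

Lemma C2_jet_mul z1 g1 H1 z2 g2 H2 : C2_jet Omega z1 g1 H1 ->
  C2_jet Omega z2 g2 H2 ->
  C2_jet Omega (fun x => z1 x * z2 x) (fun i x => z1 x * g2 i x + z2 x * g1 i x)
    (fun i j x => (z1 x * H2 i j x + g2 i x * g1 j x)
      + (z2 x * H1 i j x + g1 i x * g2 j x)).
Proof.
have dm (f1 f2 : 'rV[R]_n -> R) l1 l2 (x e : 'rV[R]_n) :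
  is_derive x e f1 l1 -> is_derive x e f2 l2 ->
    is_derive x e (fun x => f1 x * f2 x) (f1 x * l2 + f2 x * l1).
  by move=> d1 d2; exact: is_deriveM d1 d2.
move=> [cz1 cg1 cH1 d1 dd1] [cz2 cg2 cH2 d2 dd2];
  split=> [|i|i j|x Ox i|x Ox i j].
- exact: within_continuousM.
- by apply: within_continuousD; exact: within_continuousM.
- by do 2 ?apply: within_continuousD; exact: within_continuousM.
- by apply: dm; auto.
- by apply: is_deriveD; apply: dm; auto.
Qed.

Lemma C2_jet_comp (G G1 G2 : R -> R) z g H :
  (forall s : R, is_derive s 1 G (G1 s)) ->
    (forall s : R, is_derive s 1 G1 (G2 s)) ->
  continuous G2 -> C2_jet Omega z g H ->
  C2_jet Omega (fun x => G (z x)) (fun i x => G1 (z x) * g i x)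
    (fun i j x => G1 (z x) * H i j x + g i x * (G2 (z x) * g j x)).
Proof.
move=> dG dG1 cG2 [cz cg cH d1 d2].
have cd (f f1 : R -> R) : (forall s : R, is_derive s 1 f (f1 s)) ->
  continuous f.
  by move=> df s; apply/differentiable_continuous/derivable1_diffP;
    have [] := df s.
have cc (f : R -> R) : continuous f ->
  {within closure Omega, continuous (fun x => f (z x))}.
  move=> cf; apply: (@within_continuous_compose _ _ _ _ setT) => //.
  exact: continuous_subspaceT.
have cG1z := cc _ (cd _ _ dG1); have cG2z := cc _ cG2.
split=> [|i|i j|x Ox i|x Ox i j].
- exact: cc (cd _ _ dG).
- exact: within_continuousM.
- by apply: within_continuousD; do 2 ?apply: within_continuousM.
- by apply: is_derive_comp_real; auto.
- apply: (@is_deriveM _ _ (fun x => G1 (z x)) (g i)); last exact: d2.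
  by apply: is_derive_comp_real; auto.
Qed.

Lemma neumann_jet_lin (a b : R) g1 g2 : neumann_jet Omega g1 ->
  neumann_jet Omega g2 ->
  neumann_jet Omega (fun i x => a * g1 i x + b * g2 i x).
Proof.
move=> N1 N2 x nu bx onu; rewrite (eq_bigr (fun i =>
  a * (nu 0 i * g1 i x) + b * (nu 0 i * g2 i x))).
  by rewrite big_split/= -!mulr_sumr N1// N2// !mulr0 addr0.
by move=> i _; ring.
Qed.

Lemma neumann_jet_mul z1 g1 z2 g2 : neumann_jet Omega g1 ->
  neumann_jet Omega g2 ->
  neumann_jet Omega (fun i x => z1 x * g2 i x + z2 x * g1 i x).
Proof.
move=> N1 N2 x nu bx onu.
rewrite (eq_bigr (fun i => z1 x * (nu 0 i * g2 i x)
  + z2 x * (nu 0 i * g1 i x))).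
  by rewrite big_split/= -!mulr_sumr N1// N2// !mulr0 addr0.
by move=> i _; ring.
Qed.

Lemma neumann_jet_scale (a : 'rV[R]_n -> R) g : neumann_jet Omega g ->
  neumann_jet Omega (fun i x => a x * g i x).
Proof.
move=> N x nu bx onu; rewrite (eq_bigr (fun i => a x * (nu 0 i * g i x))).
  by rewrite -mulr_sumr N// mulr0.
by move=> i _; ring.
Qed.

Lemma trace_lin (a b : R) H1 H2 x : \sum_i (a * H1 i i x + b * H2 i i x) =
  a * (\sum_i H1 i i x) + b * (\sum_i H2 i i x).
Proof. by rewrite big_split/= -!mulr_sumr. Qed.

End JetAlgebra.

(** * Time slices and time quotients on space-time cylinders *)

Section Cylinders.
Context {R : realType} {n : nat}.
Implicit Types (Omega : set 'rV[R]_n) (T : \bar R) (u v : 'rV[R]_n -> R -> R).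

Lemma slice_continuous (A : set 'rV[R]_n) (I : set R)
    (f : 'rV[R]_n * R -> R) t :
  {within A `*` I, continuous f} -> I t ->
    {within A, continuous (fun x => f (x, t))}.
Proof.
move=> cf It; apply: (@within_continuous_compose _ _ _ _ (A `*` I) (fun x =>
  (x, t)) f) => //.
apply: continuous_subspaceT => x.
exact: (cvg_pair (@cvg_id _ (nbhs x)) (cvg_cst t)).
Qed.

Lemma C21_cylinder_jet Omega T u t : open Omega -> C21_cylinder Omega T u ->
  time_oo T t ->
  exists g H, C2_jet Omega (u ^~ t) g H.
Proof.
move=> oO [cu _ d1 d2] tT.
have sl (f : 'rV[R]_n * R -> R) :
    continuous_up_to (Omega `*` time_oo T) (closure Omega `*` time_oo T) f ->
    continuous_up_to Omega (closure Omega) (fun x => f (x, t)).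
  move=> [f' [cf' E]]; exists (fun x => f' (x, t)); split.
    exact: slice_continuous cf' tT.
  by move=> x Ox; exact: E.
apply: C2_jet_exists => //.
- exact: slice_continuous cu tT.
- move=> i; have [d c] := d1 i; split; last exact: sl c.
  by move=> x Ox; exact: (d (x, t)).
- move=> i j; have [d c] := d2 i j; split; last exact: sl c.
  by move=> x Ox; exact: (d (x, t)).
Qed.

(** By the mean value theorem the quotient is the time derivative at an intermediate time, and
    compactness of the closure makes the approximation uniform in [x]. *)
Lemma time_quotient Omega T u t : compact (closure Omega) ->
  C21_cylinder Omega T u ->
  time_oo T t -> forall e : R, 0 < e ->
    exists2 d, 0 < d & forall h, 0 < h < d ->
    h < t /\ forall x, Omega x ->
      `|derive1 (u x) t - h^-1 * (u x t - u x (t - h))| < e.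
Proof.
move=> cO [_ [du [f [cf Ef]]] _ _] tT e e0.
have [r /= r0 Hr] := (nbhs_ballP _ _).1 (compact_slices_equicontinuous cO cf tT
  e0).
have [t0 tltT] := tT.
exists (Num.min r t); first by rewrite lt_min r0.
move=> h; rewrite lt_min => /andP[h0 /andP[hr ht]]; split => // x Ox.
have inT s : t - h <= s <= t -> time_oo T s.
  move=> /andP[s1 s2]; split; first by lra.
  by apply: le_lt_trans tltT; rewrite lee_fin.
have dux s : t - h <= s <= t -> is_derive s 1 (u x) (f (x, s)).
  move=> /inT Ts; rewrite -Ef//; split; first exact: (du (x, s)).
  exact: esym (derive1E _ _).
have [|||c] := @MVT _ (u x) (fun s => f (x, s)) (t - h) t.
- by rewrite ltrBlDr ltrDl.
- by move=> s; rewrite in_itv/= => /andP[s1 s2]; apply: dux; rewrite !ltW.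
- apply: derivable_within_continuous => s; rewrite in_itv/= => hs.
  by have [] := dux s hs.
rewrite in_itv/= => /andP[c1 c2] ->; rewrite subKr mulrCA mulVf ?gt_eqF// mulr1.
rewrite (Ef (x, t))//; apply: Hr.
- by rewrite /ball/= gtr0_norm ?subr_gt0//; lra.
- by apply: inT; rewrite !ltW.
- exact: subset_closure.
Qed.

End Cylinders.

(** Completing the square bounds the left-hand side by [q ^+ 2 / (4 * mu)] for every real [w]. Here
    [w] stands for [u], whose sign is not part of [classical_solution]. *)
Lemma logistic_bound (R : realFieldType) (mu c q w : R) :
  0 < mu -> 0 <= q -> q <= 2 * c -> q * w - mu * w ^+ 2 <= c ^+ 2 / mu.
Proof.
move=> mu0 q0 qc; rewrite ler_pdivlMr//.
have c0 : 0 <= 2 * c by exact: le_trans qc.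
have h1 : q ^+ 2 <= (2 * c) ^+ 2 by rewrite ler_sqr.
have h2 := sqr_ge0 (q - 2 * mu * w).
move: h1 h2; rewrite !expr2; lra.
Qed.

(** * A priori estimates for the solution *)

Section Estimates.
Context {R : realType} {n : nat}.
Context (Omega : set 'rV[R]_n) (gamma : R -> R) (mu : R) (T : \bar R)
  (u0 : 'rV[R]_n -> R) (u v : 'rV[R]_n -> R -> R).
Context (sO : smooth_bounded_domain Omega)
  (sol : classical_solution Omega gamma mu u0 T u v).

(* [z] stands for a regular approximation of the resolvent of [u0]. *)
Context (z : 'rV[R]_n -> R) (zg : 'I_n -> 'rV[R]_n -> R)
  (zH : 'I_n -> 'I_n -> 'rV[R]_n -> R) (e : R).
Context (Jz : C2_jet Omega z zg zH) (Nz : neumann_jet Omega zg) (e0 : 0 < e)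
  (zu0 : forall x, Omega x -> `|z x - \sum_i zH i i x - u0 x| <= e).

Let oO : open Omega. Proof. by case: sO. Qed.

(** The elliptic equation is given only at positive times, so [v] and [z] are compared at a small
    time [t]: their sources differ by at most [2 * e] in the relevant direction, and returning to
    time [0] costs another [e]. *)
Lemma initial_comparison t0 : time_oo T t0 -> forall x, closure Omega x ->
  v x 0 - z x <= 3 * e.
Proof.
move=> [t00 t0T] x clx.
have [[cu Cu] [cv Cv] vge0 [pde neu] init] := sol.
have cO := compact_closure_domain sO.
have I0 : time_co T 0 by split => //; apply: lt_trans t0T; rewrite lte_fin.
have nu := compact_slices_equicontinuous cO cu I0 e0.
have nv := compact_slices_equicontinuous cO cv I0 e0.
have [r /= r0 Hr] := (nbhs_ballP _ _).1 (filterI nu nv).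
pose t := Num.min t0 (r / 2).
have t_gt0 : 0 < t by rewrite lt_min t00 divr_gt0.
have tT : time_oo T t by split => //; apply: le_lt_trans t0T;
  rewrite lee_fin ge_min lexx.
have tTc : time_co T t by case: tT => /ltW.
have [] : ((fun s => time_co T s -> forall x, closure Omega x ->
  `|u x 0 - u x s| < e) `&`
    (fun s => time_co T s -> forall x, closure Omega x ->
      `|v x 0 - v x s| < e)) t.
  apply: Hr; rewrite /ball/= sub0r normrN gtr0_norm//.
  by apply: (@le_lt_trans _ _ (r / 2)); [rewrite ge_min lexx orbT|lra].
move=> /(_ tTc) Hu /(_ tTc x clx).
have [vg [vH Jv]] := C21_cylinder_jet oO Cv tT.
have Nv := neumann_jetP oO Jv (neu t tT).2.
have := elliptic_comparison sO (C2_jet_lin 1 (-1) Jv Jz)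
  (neumann_jet_lin 1 (-1) Nv Nz)
  (M := 2 * e) _ clx.
have H y : Omega y -> 1 * v y t + -1 * z y -
    \sum_i (1 * vH i i y + -1 * zH i i y) <= 2 * e.
  move=> Oy; rewrite trace_lin.
  have [_] := pde y t Oy tT; rewrite (C2_jet_laplacian oO Jv Oy).
  have := Hu y (subset_closure Oy); rewrite (init y Oy).
  have := zu0 Oy; rewrite ler_norml ltr_norml; lra.
by move=> /(_ H); rewrite ltr_norml; lra.
Qed.

Context (u0_ge0 : forall x, Omega x -> 0 <= u0 x).

(** This is the comparison principle for [- z], as [u0] is nonnegative. *)
Lemma approximate_resolvent_lower_bound x : closure Omega x ->
  - e <= z x - \sum_i zH i i x /\ - e <= z x.
Proof.
move=> clx.
have lo y : Omega y -> 0 * z y + -1 * z y -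
    \sum_i (0 * zH i i y + -1 * zH i i y) <= e.
  move=> Oy; rewrite trace_lin; have := u0_ge0 Oy.
  by have := zu0 Oy; rewrite ler_norml; lra.
(* The coefficients [0] and [-1] produce a jet of [- z]. *)
have JN := C2_jet_lin 0 (-1) Jz Jz.
have := elliptic_comparison sO JN (neumann_jet_lin 0 (-1) Nz Nz) lo clx.
have := within_closure_le (within_continuous_laplacian JN) lo clx.
rewrite trace_lin; lra.
Qed.

(** A maximum point of [v - z] may lie on the boundary, where the equation is available only through
    continuity. *)
Lemma elliptic_equation_closure t x vg vH : time_oo T t ->
  C2_jet Omega (v ^~ t) vg vH ->
  closure Omega x -> v x t - \sum_i vH i i x <= u x t.
Proof.
move=> tT Jv clx; have [[cu Cu] _ _ [pde _] _] := sol.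
have cH := within_continuous_laplacian Jv.
have [cu' _ _ _] := Cu.
have cut : {within closure Omega, continuous (u ^~ t)} :=
  slice_continuous cu' tT.
have := within_closure_le (@within_continuous_lin _ _ _ 1 (-1) _ _ cH cut)
  (M := 0) _ clx.
have H y : Omega y -> 1 * (v y t - \sum_i vH i i y) + -1 * u y t <= 0.
  move=> Oy; have [_] := pde y t Oy tT; rewrite (C2_jet_laplacian oO Jv Oy);
    lra.
by move=> /(_ H); lra.
Qed.

Context (g3 : C3_halfline gamma) (g_gt0 : 0 < gamma 0)
  (g_ge0 : forall s, 0 <= s -> 0 <= gamma s)
  (g_le : forall s, 0 <= s -> gamma s <= gamma 0) (mu_gt0 : 0 < mu).

(* The difference quotient of [v] plus [gamma v u + c v] satisfies, up to a small
   error, the elliptic problem with right-hand side bounded by [c^2 / mu]. *)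
Lemma time_difference_bound t : time_oo T t -> forall d : R, 0 < d ->
  exists2 h, 0 < h < t & forall x, closure Omega x ->
    h^-1 * (v x t - v x (t - h)) + gamma (v x t) * u x t
      + (gamma 0 + mu) * v x t <= (gamma 0 + mu) ^+ 2 / mu + d.
Proof.
move=> tT d d0; have [[cu Cu] [cv Cv] vge0 [pde neu] _] := sol.
have [r r0 Hr] := time_quotient (compact_closure_domain sO) Cu tT d0.
pose h := r / 2; have h0 : 0 < h by rewrite divr_gt0.
have [|ht Hh] := Hr h; first by rewrite h0/= /h; lra.
exists h; first by rewrite h0.
have tTc : time_co T t by case: tT => /ltW.
have tT' : time_oo T (t - h).
  split; first by rewrite subr_gt0.
  by case: tT => _; apply: le_lt_trans; rewrite lee_fin; lra.
have [vg [vH Jv]] := C21_cylinder_jet oO Cv tT.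
have Nv := neumann_jetP oO Jv (neu t tT).2.
have [vg' [vH' Jv']] := C21_cylinder_jet oO Cv tT'.
have Nv' := neumann_jetP oO Jv' (neu _ tT').2.
have [ug [uH Ju]] := C21_cylinder_jet oO Cu tT.
have Nu := neumann_jetP oO Ju (neu t tT).1.
have [G [G1 [G2 [EG dG dG1 cG2]]]] := C3_halfline_extension g3.
(* The jet is built with the extension [G], which agrees with [gamma] along [v] because [v] is
   nonnegative on the closure. *)
have [wg [wH [Jw Nw]]] : exists wg wH,
    C2_jet Omega (fun x => gamma (v x t) * u x t) wg wH /\ neumann_jet Omega wg.
  have Ew y : closure Omega y -> G (v y t) * u y t = gamma (v y t) * u y t.
    by move=> cly; rewrite EG// vge0.
  have Jw := C2_jet_ext oO Ew (C2_jet_mul (C2_jet_comp dG dG1 cG2 Jv) Ju).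
  do 2 eexists; split; first exact: Jw.
  by apply: neumann_jet_mul Nu; exact: neumann_jet_scale.
have JZ := C2_jet_lin 1 1 (C2_jet_lin h^-1 (- h^-1) Jv Jv')
  (C2_jet_lin 1 (gamma 0 + mu) Jw Jv).
have NZ := neumann_jet_lin 1 1 (neumann_jet_lin h^-1 (- h^-1) Nv Nv')
  (neumann_jet_lin 1 (gamma 0 + mu) Nw Nv).
move=> x clx.
have := elliptic_comparison sO JZ NZ (M := (gamma 0 + mu) ^+ 2 / mu + d) _ clx.
have H y : Omega y ->
    1 * (h^-1 * v y t + - h^-1 * v y (t - h))
      + 1 * (1 * (gamma (v y t) * u y t) + (gamma 0 + mu) * v y t)
    - \sum_i (1 * (h^-1 * vH i i y + - h^-1 * vH' i i y)
      + 1 * (1 * wH i i y + (gamma 0 + mu) * vH i i y))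
    <= (gamma 0 + mu) ^+ 2 / mu + d.
  move=> Oy; have cly := subset_closure Oy.
  rewrite (trace_lin 1 1 (fun i j x => h^-1 * vH i j x + - h^-1 * vH' i j x)
    (fun i j x => 1 * wH i j x + (gamma 0 + mu) * vH i j x) y) !trace_lin.
  have [ut vt] := pde y t Oy tT; have [_ vt'] := pde y (t - h) Oy tT'.
  rewrite (C2_jet_laplacian oO Jw Oy) in ut;
    rewrite (C2_jet_laplacian oO Jv Oy) in vt.
  rewrite (C2_jet_laplacian oO Jv' Oy) in vt'.
  have := Hh y Oy; rewrite ltr_norml => /andP[Q _].
  have vy := vge0 y t cly tTc.
  have gv0 := g_ge0 vy; have gv := g_le vy.
  (* This sum is the coefficient [q] of [u] on the right-hand side, to be placed in the range that
     [logistic_bound] requires. *)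
  have q0 : 0 <= gamma (v y t) + mu + (gamma 0 + mu).
    by move: gv0 mu_gt0 g_gt0; lra.
  have q1 : gamma (v y t) + mu + (gamma 0 + mu) <= 2 * (gamma 0 + mu).
    by move: gv; lra.
  have := logistic_bound (u y t) mu_gt0 q0 q1.
  (* [I - Delta] turns the difference quotient of [v] into that of [u], which is close to [u_t]. *)
  have E : u y t - u y (t - h) = (v y t - v y (t - h))
    - (\sum_i vH i i y - \sum_i vH' i i y).
    by rewrite -vt -vt'; ring.
  have Ec : (gamma 0 + mu) * (u y t) = (gamma 0 + mu)
    * (v y t - \sum_i vH i i y).
    by rewrite -vt; ring.
  by move: Q Ec; rewrite E ut; lra.
move=> /(_ H); lra.
Qed.

Lemma positive_time_bound t x : time_oo T t -> closure Omega x ->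
  (forall y, closure Omega y -> v y t - z y <= v x t - z x) ->
  (forall s, 0 < s < t -> v x s <= v x t) ->
  v x t - z x <= (gamma 0 + mu) / mu + e.
Proof.
move=> tT clx spmax tmax; have [[cu Cu] [cv Cv] vge0 [pde neu] _] := sol.
have tTc : time_co T t by case: tT => /ltW.
have [lo zlo] := approximate_resolvent_lower_bound clx.
have c0 : 0 < gamma 0 + mu by rewrite addr_gt0.
(* The threshold is [e] because [z - Delta z >= - e]: above it, [u >= (v - z) + (z - Delta z)] is
   positive at the maximum. *)
have [small|big] := leP (v x t - z x) e.
  by apply: (le_trans small); rewrite lerDr ltW// divr_gt0.
have [vg [vH Jv]] := C21_cylinder_jet oO Cv tT.
have Nv := neumann_jetP oO Jv (neu t tT).2.
have u_ge0 : 0 <= u x t.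
  have := max_trace sO (C2_jet_lin 1 (-1) Jv Jz) (neumann_jet_lin 1 (-1) Nv Nz)
    clx.
  rewrite trace_lin => tr.
  have {}tr : 1 * (\sum_i vH i i x) + -1 * (\sum_i zH i i x) <= 0.
    by apply: tr => y cly; have := spmax y cly; lra.
  have := elliptic_equation_closure tT Jv clx; move: lo big; lra.
suff : v x t <= (gamma 0 + mu) / mu by move: zlo; lra.
rewrite -(ler_pM2l c0) mulrA -expr2.
(* The slack [d] absorbs the error of the difference quotient; the quotient and
   [gamma (v x t) * u x t] are then dropped as nonnegative. *)
apply/ler_addgt0Pr => d d0.
have [h /andP[h0 ht] Hh] := time_difference_bound tT d0.
have := Hh x clx; have vx := vge0 x t clx tTc.
have : 0 <= gamma (v x t) * u x t by rewrite mulr_ge0// g_ge0.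
have : 0 <= h^-1 * (v x t - v x (t - h)).
  apply: mulr_ge0; first by rewrite invr_ge0 ltW.
  by rewrite subr_ge0; apply: tmax; lra.
lra.
Qed.

(** [v - z] attains its maximum over the compact cylinder up to time [t]; [initial_comparison]
    bounds it at time [0], [positive_time_bound] at a positive time. *)
Lemma upper_bound t x : time_oo T t -> closure Omega x ->
  forall s, 0 <= s <= t -> v x s <= z x + (gamma 0 + mu) / mu + 3 * e.
Proof.
move=> tT clx s st; have [_ [cv Cv] _ _ _] := sol; have [t_gt0 ltT] := tT.
have sub : closure Omega `*` `[0, t] `<=` closure Omega `*` time_co T.
  move=> [y r] /= [cly]; rewrite in_itv/= => /andP[r0 rt]; split => //;
    split => //.
  by apply: le_lt_trans ltT; rewrite lee_fin.
have [cz _ _ _ _] := Jz.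
have cpsi : {within closure Omega `*` `[0, t], continuous (fun p =>
  v p.1 p.2 - z p.1)}.
  apply: within_continuousB; first exact: continuous_subspaceW cv.
  apply: (@within_continuous_compose _ _ _ _ (closure Omega) fst z) => //.
    by apply: continuous_subspaceT => p; exact: cvg_fst.
  by move=> p [].
have [||[y r] /set_mem[/= cly]] := compact_EVT_max _ _ cpsi.
- by exists (x, s); split => //=; rewrite in_itv.
- apply: compact_setX; last exact: segment_compact.
  exact: compact_closure_domain.
rewrite in_itv/= => /andP[r0 rt] pmax.
have {}pmax y' r' : closure Omega y' -> 0 <= r' <= t ->
  v y' r' - z y' <= v y r - z y.
  by move=> cly' r't; apply: (pmax (y', r')); apply/mem_set; split => //=;
    rewrite in_itv.
have g0 : 0 <= (gamma 0 + mu) / mu by rewrite divr_ge0 ?addr_ge0 ?ltW.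
suff : v y r - z y <= (gamma 0 + mu) / mu + 3 * e by have := pmax x s clx st;
  lra.
move: r0; rewrite le_eqVlt => /orP[/eqP r0|r0].
  by have := initial_comparison tT cly; rewrite -r0; lra.
have rT : time_oo T r by split => //; apply: le_lt_trans ltT; rewrite lee_fin.
have := @positive_time_bound r y rT cly.
have h1 y' : closure Omega y' -> v y' r - z y' <= v y r - z y.
  by move=> cly'; apply: pmax => //; rewrite rt ltW.
have h2 r' : 0 < r' < r -> v y r' <= v y r.
  move=> /andP[r'0 r'r]; have := pmax y r' cly; rewrite ltW//=.
  by move=> /(_ (le_trans (ltW r'r) rt)); lra.
by move=> /(_ h1 h2); move: e0; lra.
Qed.

End Estimates.

Theorem lemma3p7 (R : realType) (n : nat) (hn : (1 <= n)%N)
    (Omega : set 'rV[R]_n) (hOmega : smooth_bounded_domain Omega)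
    (gamma : R -> R) (hgamma3 : C3_halfline gamma)
    (hgamma_pos : forall s : R, 0 < s -> 0 < gamma s)
    (hgamma_dec : forall s : R, 0 < s -> derive1 gamma s <= 0)
    (u0 : 'rV[R]_n -> R) (hu0 : {within closure Omega, continuous u0})
    (hu0_ge0 : forall x, closure Omega x -> 0 <= u0 x)
    (hu0_neq0 : exists2 x, closure Omega x & u0 x <> 0)
    (vstar mu : R) (hvstar : vstar = 0) (hmu : gamma vstar < mu)
    (Tmax : \bar R) (u v : 'rV[R]_n -> R -> R)
    (huv : maximal_classical_solution Omega gamma mu u0 Tmax u v)
    (v0 : 'rV[R]_n -> R) (hv0 : neumann_resolvent Omega u0 v0)
    (x : 'rV[R]_n) (t : R) (hx : Omega x) (ht : 0 <= t) (htT : (t%:E < Tmax)%E) :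
  v x t <= v0 x + mu / (mu - gamma vstar).
Proof.
subst vstar; have [T0 sol _] := huv.
have g_le s1 s2 : 0 <= s1 -> s1 <= s2 -> gamma s2 <= gamma s1.
  apply: (@ler0_derive1_nincry _ gamma 0).
  - move=> s; rewrite in_itv/= andbT => s0.
    by have [_ /(_ 0%N isT) [d _]] := hgamma3; exact: d.
  - by move=> s; rewrite in_itv/= andbT; exact: hgamma_dec.
  - have [c _] := hgamma3; apply: continuous_subspaceW c => s /=.
    by rewrite in_itv/= andbT.
(* Positivity is assumed only away from [0]; here it comes from [gamma 1 <= gamma 0]. *)
have g_gt0 : 0 < gamma 0.
  by apply: lt_le_trans (g_le 0 1 _ _) => //; exact: hgamma_pos.
have g_ge0 s : 0 <= s -> 0 <= gamma s.
  by rewrite le_eqVlt => /orP[/eqP <-|/hgamma_pos]; exact: ltW.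
have mu_gt0 : 0 < mu by exact: lt_trans hmu.
(* [t] may be [0], whereas the estimates need a positive time. *)
have [t1 [tt1 t1_gt0 t1T]] : exists t1, [/\ t <= t1, 0 < t1 & (t1%:E < Tmax)%E].
  move: ht; rewrite le_eqVlt => /orP[/eqP <-|t0]; last by exists t.
  move: T0; case: (Tmax) => [r| |//]; last by exists 1;
    rewrite ler01 ltr01 ltry.
  rewrite lte_fin => r0; exists (r / 2); rewrite lte_fin; split; lra.
(* This amounts to [mu ^+ 2 - gamma 0 ^+ 2 <= mu ^+ 2]. *)
have gap : (gamma 0 + mu) / mu <= mu / (mu - gamma 0).
  rewrite ler_pdivrMr// mulrAC ler_pdivlMr ?subr_gt0//; nra.
apply/ler_addgt0Pr => d d0.
(* Three quarters pay for the error in [upper_bound], the last one for the distance from [z] to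
   [v0]. *)
pose e := d / 4; have e0 : 0 < e by rewrite divr_gt0.
have [z [z2 zN zv0 zu0]] := hv0 e e0.
have oO : open Omega by case: hOmega.
have [zg [zH Jz]] := C2_closure_jet oO z2.
have clx := subset_closure hx.
have zu y : Omega y -> `|z y - \sum_i zH i i y - u0 y| <= e.
  by move=> Oy; rewrite -(C2_jet_laplacian oO Jz Oy) zu0.
have := upper_bound hOmega sol Jz (neumann_jetP oO Jz zN) e0 zu
  (fun y Oy => hu0_ge0 y (subset_closure Oy)) hgamma3 g_gt0 g_ge0
  (fun s s0 => g_le 0 s (lexx 0) s0) mu_gt0 (conj t1_gt0 t1T) clx (s := t).
rewrite ht tt1 => /(_ isT); have := zv0 x clx.
rewrite ler_norml /e; lra.
Qed.
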